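(* Let $A,B\in\mathbb{C}^{d\times d}$ be Hermitian matrices and let $(a_i)_{i=1}^d$ and $(b_j)_{j=1}^d$ be orthonormal eigenbases of $A$ and $B$, respectively, with $Aa_i=\lambda_i(A)a_i$ and $Bb_j=\lambda_j(B)b_j$. Then $$\lambda_{\max}(A+B)\le\max\big\{\lambda_i(A)+\lambda_j(B)\;\big|\;i,j\in\{1,\dots,d\},\ \langle a_i,b_j\rangle\ne0\big\}.$$
   Context: For a Hermitian $X\in\mathbb{C}^{d\times d}$, $\lambda_1(X)\ge\cdots\ge\lambda_d(X)$ are its eigenvalues (with multiplicity) in decreasing order, and $\lambda_{\max}(X)=\lambda_1(X)$. *)

(* Defs.v *)
From HB Require Import structures.
From mathcomp Require Import all_boot all_order all_algebra.
From mathcomp Require Import spectral.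
From mathcomp Require Import complex.
From mathcomp Require Import unstable reals.

Set Implicit Arguments.
Unset Strict Implicit.
Unset Printing Implicit Defensive.

Import Order.TTheory GRing.Theory Num.Theory.
Local Open Scope ring_scope.
Local Open Scope complex_scope.

(* The roots in R[i] of the characteristic polynomial, with multiplicity.     *)
Definition char_roots (R : realType) (d : nat) (X : 'M[R[i]]_d) : seq R[i] :=
  sval (closed_field_poly_normal (char_poly X)).

(* Taking real parts loses nothing when X is Hermitian, as all its            *)
(* eigenvalues are then real: see eigenvaluesP.                               *)
Definition eigenvalues (R : realType) (d : nat) (X : 'M[R[i]]_d) : seq R :=
  sort >=%R [seq complex.Re z | z <- char_roots X].

(* Indices start at 0: lambda X i is the (i+1)-st largest eigenvalue.         *)
Definition lambda (R : realType) (d : nat) (X : 'M[R[i]]_d) (i : nat) : R :=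
  (eigenvalues X)`_i.

Definition lambda_max (R : realType) (d : nat) (X : 'M[R[i]]_d) : R :=
  lambda X 0.

Definition inner (R : realType) (d : nat) (u v : 'cV[R[i]]_d) : R[i] :=
  dotmx u^T v^T.

(* d orthonormal vectors of a space of dimension d always form a basis.       *)
Definition orthonormal_basis (R : realType) (d : nat)
    (a : 'I_d -> 'cV[R[i]]_d) : Prop :=
  forall i j, inner (a i) (a j) = (i == j)%:R.

(* The maximum of a nonempty sequence; the default 0 only matters for [::].   *)
Definition seq_max (R : realType) (s : seq R) : R :=
  \big[Num.max/head 0 s]_(x <- s) x.

Lemma char_rootsP (R : realType) (d : nat) (X : 'M[R[i]]_d) :
  char_poly X = \prod_(z <- char_roots X) ('X - z%:P).
Proof.
rewrite /char_roots; case: closed_field_poly_normal => s /= {1}->.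
by rewrite (monicP (char_poly_monic X)) scale1r.
Qed.

Lemma size_eigenvalues (R : realType) (d : nat) (X : 'M[R[i]]_d) :
  size (eigenvalues X) = d.
Proof.
rewrite size_sort size_map.
by have := size_char_poly X; rewrite char_rootsP size_prod_XsubC => -[].
Qed.

Lemma eigenvalues_sorted (R : realType) (d : nat) (X : 'M[R[i]]_d) :
  sorted >=%R (eigenvalues X).
Proof. by apply: sort_sorted => x y; exact: le_total. Qed.

Lemma eigenvaluesP (R : realType) (d : nat) (X : 'M[R[i]]_d) :
  X \is hermsymmx ->
  char_poly X = \prod_(x <- eigenvalues X) ('X - (x%:C)%:P).
Proof.
move=> hX; rewrite {1}char_rootsP (perm_big _ (permEl (perm_sort _ _))) big_map.
apply: eq_big_seq => z zX; suff : z \is Num.real.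
  by move=> /complex_realP[x ->].
have : root (char_poly X) z by rewrite char_rootsP root_prod_XsubC.
rewrite -eigenvalue_root_char => /eigenvalueP[v vX vN0].
have vv_gt0 : 0 < dotmx v v by rewrite dnorm_gt0.
have zvv : z * dotmx v v = Num.conj z * dotmx v v.
  have /is_hermitianmxP := hX; rewrite expr0 scale1r => XE.
  rewrite !dotmxE; transitivity ((v *m X *m map_mx Num.conj v^T) 0 0).
    by rewrite vX -scalemxAl [RHS]mxE.
  by rewrite {1}XE -mulmxA -map_mxM -trmx_mul vX linearZ map_mxZ -scalemxAr [LHS]mxE.
by apply/CrealP/esym/(mulIf (lt0r_neq0 vv_gt0)).
Qed.

Lemma seq_maxP (R : realType) (s : seq R) : s != [::] ->
  seq_max s \in s /\ forall x, x \in s -> x <= seq_max s.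
Proof.
case: s => // y s _; rewrite /seq_max /=; split; last first.
  by move=> x xs; exact: (le_bigmax_seq _ x xpredT id).
rewrite big_seq; apply: (big_ind (fun x => x \in y :: s)) => // [|u v us vs].
  exact: mem_head.
by rewrite /Num.max; case: ifP.
Qed.

(* Main.v *)
Require Import Defs.
From mathcomp Require Import all_boot all_order all_algebra.
From mathcomp Require Import spectral complex reals.

Import Order.TTheory GRing.Theory Num.Theory.
Local Open Scope ring_scope.
Local Open Scope complex_scope.

(* Let M be the right-hand side. Whenever i <= k and <a_i, b_j> != 0 we have
   lambda_k(A) <= lambda_i(A) <= M - lambda_j(B), so the span of a_1, ..., a_k
   is contained in the span of the b_j with M - lambda_j(B) >= lambda_k(A).
   Thus the spectral projections of A onto its k largest eigenvalues are
   dominated by spectral projections of M - B, and summation by parts turns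
   this domination of projections into A <= M - B as quadratic forms. It
   remains to evaluate both forms at a top eigenvector of A + B. *)

(** Pointwise form of summation by parts: cutting [u] into layers turns a sum weighted by [u] into a
    combination of partial sums of the weights. *)
Lemma telescope_tail (V : zmodType) (u : nat -> V) (n i : nat) : (i <= n)%N ->
  u i = u n + \sum_(k < n) (u k - u k.+1) *+ (i <= k)%N.
Proof.
elim: n => [|n IHn]; first by rewrite leqn0 => /eqP->; rewrite big_ord0 addr0.
rewrite leq_eqVlt => /predU1P[->|i_le_n].
  by rewrite big1 ?addr0 // => k _; rewrite leqNgt ltn_ord mulr0n.
rewrite big_ord_recr /= -ltnS i_le_n mulr1n addrCA.
by rewrite [u n.+1 + _]addrC subrK addrC; apply: IHn.
Qed.

(** Since [u] decreases, the levels with [u k <= x] form a final segment, so their drops telescope: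
    the left side is the largest of the values [u 0, ..., u n] not exceeding [x]. *)
Lemma sum_layers_le (R : realDomainType) (u : nat -> R) (n : nat) (x : R) :
    {in [pred k | (k <= n)%N] &, {homo u : i j / (i <= j)%N >-> j <= i}} ->
  u n <= x -> u n + \sum_(k < n) (u k - u k.+1) *+ (u k <= x)%R <= x.
Proof.
elim: n => [|n IHn] u_dec un_le_x; first by rewrite big_ord0 addr0.
rewrite big_ord_recr /=; case: (lerP (u n) x) => [un_x | x_lt_un].
  rewrite mulr1n addrCA [u n.+1 + _]addrC subrK addrC IHn //.
  move=> i j; rewrite !inE => i_le j_le.
  by apply: u_dec; rewrite inE (leq_trans _ (leqnSn n)).
rewrite addr0 big1 ?addr0 // => k _; rewrite leNgt (lt_le_trans x_lt_un) //.
by apply: u_dec; rewrite ?inE ?leqnSn // ltnW // ltnW // ltnS.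
Qed.

(* Stochastic domination of the weighted values (u, p) by (g, q). *)
Lemma sum_weighted_le (R : realDomainType) (n : nat) (J : finType)
    (u : nat -> R) (g : J -> R) (p : 'I_n.+1 -> R) (q : J -> R) :
    {in [pred k | (k <= n)%N] &, {homo u : i j / (i <= j)%N >-> j <= i}} ->
    (forall j, u n <= g j) -> (forall j, 0 <= q j) ->
    \sum_i p i = \sum_j q j ->
    (forall k : 'I_n.+1,
      \sum_(i < n.+1 | (i <= k)%N) p i <= \sum_(j | u k <= g j) q j) ->
  \sum_(i < n.+1) u i * p i <= \sum_j g j * q j.
Proof.
move=> u_dec un_le_g q_ge0 sum_pq dom.
have layers (I : finType) (w : I -> R) (P : nat -> pred I) :
    \sum_i (u n + \sum_(k < n) (u k - u k.+1) *+ P k i) * w i =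
    u n * (\sum_i w i) +
    \sum_(k < n) (u k - u k.+1) * \sum_(i | P k i) w i.
  under eq_bigr do rewrite mulrDl mulr_suml.
  rewrite big_split /= -mulr_sumr exchange_big /=; congr (_ + _).
  apply: eq_bigr => k _; rewrite mulr_sumr [RHS]big_mkcond /=.
  by apply: eq_bigr => i _; case: (P k i); rewrite ?mulr1n ?mulr0n ?mul0r.
have -> : \sum_(i < n.+1) u i * p i =
    \sum_(i < n.+1) (u n + \sum_(k < n) (u k - u k.+1) *+ (i <= k)%N) * p i.
  apply: eq_bigr => i _; congr (_ * _).
  by apply: telescope_tail; rewrite -ltnS.
(* The middle sum rounds each [g j] down to a value of [u]. Layer by layer, [dom] gives the first
   inequality, because the drops of [u] are nonnegative; [sum_layers_le] gives the second. *)
apply: (@le_trans _ _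
  (\sum_j (u n + \sum_(k < n) (u k - u k.+1) *+ (u k <= g j)%R) * q j)).
  rewrite (layers _ p (fun k (i : 'I_n.+1) => (i <= k)%N)).
  rewrite (layers _ q (fun k j => u k <= g j)) sum_pq lerD2l.
  apply: ler_sum => k _; apply: ler_wpM2l.
    rewrite subr_ge0 u_dec ?inE //; first exact: ltnW.
  exact: (dom (widen_ord (leqnSn n) k)).
apply: ler_sum => j _; apply: ler_wpM2r => //.
exact: sum_layers_le.
Qed.

Section Inner.
Context {R : realType} {d : nat}.
Implicit Types (u v w : 'cV[R[i]]_d) (a b : 'I_d -> 'cV[R[i]]_d).

Lemma inner_suml (I : Type) (r : seq I) (P : pred I) (c : I -> R[i])
    (f : I -> 'cV[R[i]]_d) w :
  inner (\sum_(i <- r | P i) c i *: f i) w =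
  \sum_(i <- r | P i) c i * inner (f i) w.
Proof.
rewrite /inner linear_sum linear_sumlz; apply: eq_bigr => i _.
by rewrite linearZ /= linearZl_LR.
Qed.

Lemma innerDl u v w : inner (u + v) w = inner u w + inner v w.
Proof. by rewrite /inner linearD linearDl. Qed.

Lemma innerZl (c : R[i]) v w : inner (c *: v) w = c * inner v w.
Proof. by rewrite /inner linearZ /= linearZl_LR. Qed.

Lemma inner_conj u v : inner u v = (inner v u)^*%R.
Proof. by rewrite /inner hermC expr0 mul1r. Qed.

Lemma inner_gt0 v : (0 < inner v v) = (v != 0).
Proof. by rewrite /inner dnorm_gt0 trmx_eq0. Qed.

Lemma orthonormal_expansion a v : orthonormal_basis a ->
  v = \sum_i inner v (a i) *: a i.
Proof.
move=> oa; pose M := \matrix_(i < d) (a i)^T.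
have M_unitary : M \is unitarymx.
  by apply/row_unitarymxP => i j; rewrite !rowK; exact: oa.
(* For the square matrix [M] a right inverse is also a left inverse, so orthonormality of the rows
   yields completeness. *)
have : v^T *m (M^t*)%sesqui *m M = v^T.
  rewrite -mulmxA; move/unitarymxP: M_unitary => /mulmx1C ->.
  by rewrite mulmx1.
move/(congr1 trmx); rewrite trmxK => {1}<-.
rewrite mulmx_sum_row linear_sum; apply: eq_bigr => i _.
rewrite rowK linearZ /= trmxK; congr (_ *: _).
by rewrite /inner dotmxE !mxE; apply: eq_bigr => k _; rewrite !mxE.
Qed.

Lemma parseval a v : orthonormal_basis a ->
  inner v v = \sum_i `|inner v (a i)| ^+ 2.
Proof.
move=> oa; rewrite {1}(orthonormal_expansion a v oa) inner_suml.
by apply: eq_bigr => i _; rewrite normCK [inner (a i) v]inner_conj.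
Qed.

Lemma inner_diagonal a v (X : 'M[R[i]]_d) (c : 'I_d -> R[i]) :
    orthonormal_basis a -> (forall i, X *m a i = c i *: a i) ->
  inner (X *m v) v = \sum_i c i * `|inner v (a i)| ^+ 2.
Proof.
move=> oa eX; rewrite {1}(orthonormal_expansion a v oa) mulmx_sumr.
under eq_bigr do rewrite -scalemxAr eX scalerA.
rewrite inner_suml; apply: eq_bigr => i _.
by rewrite normCK [inner (a i) v]inner_conj mulrAC mulrC mulrA mulrC.
Qed.

(* The hypothesis says that span {a_i | P i} lies in span {b_j | Q j}. *)
Lemma le_sum_norm_inner a b v (P Q : pred 'I_d) :
    orthonormal_basis a -> orthonormal_basis b ->
    (forall i j, P i -> inner (a i) (b j) != 0 -> Q j) ->
  \sum_(i | P i) `|inner v (a i)| ^+ 2 <= \sum_(j | Q j) `|inner v (b j)| ^+ 2.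
Proof.
(* [w] is the orthogonal projection of [v] onto the span of the [b j] with [Q j]. It has the same
   coefficients as [v] along each [a i] with [P i], so the claim is Bessel's inequality for [w]. *)
move=> oa ob PQ; pose w := \sum_(j | Q j) inner v (b j) *: b j.
have wa i : P i -> inner v (a i) = inner w (a i).
  move=> Pi; rewrite {1}(orthonormal_expansion b v ob) !inner_suml.
  rewrite [RHS]big_mkcond /=; apply: eq_bigr => j _.
  case: ifPn => // /negP nQj; rewrite [inner (b j) _]inner_conj.
  have /eqP-> : inner (a i) (b j) == 0 by apply/negPn/negP => /(PQ i j Pi).
  by rewrite conjC0 mulr0.
have wb j : inner w (b j) = if Q j then inner v (b j) else 0.
  rewrite inner_suml; under eq_bigr do rewrite ob mulr_natr mulrb.
  rewrite -big_mkcondr; case: ifPn => [Qj | /negPf nQj].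
    by apply: big_pred1 => k /=; case: eqP => [->|]; rewrite ?Qj ?andbF.
  by apply: big_pred0 => k /=; case: eqP => [->|]; rewrite ?nQj ?andbF.
have ww : inner w w = \sum_(j | Q j) `|inner v (b j)| ^+ 2.
  rewrite (parseval b w ob) [RHS]big_mkcond; apply: eq_bigr => j _.
  by rewrite wb; case: ifP => // _; rewrite normr0 expr0n.
clearbody w.
apply: (@le_trans _ _ (inner w w)); last by rewrite ww.
rewrite (parseval a w oa) [leLHS]big_mkcond; apply: ler_sum => i _.
by case: ifP => [/wa-> // | _]; rewrite exprn_ge0.
Qed.

(** Otherwise Parseval in the basis [a] would give the unit vector [b j] norm zero. *)
Lemma exists_inner_neq0 a b j : orthonormal_basis a -> orthonormal_basis b ->
  exists i, inner (a i) (b j) != 0.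
Proof.
move=> oa ob; apply/existsP; rewrite -[X in is_true X]negbK negb_exists.
apply/negP => /forallP ab0; have : inner (b j) (b j) = 0.
  rewrite (parseval a _ oa) big1 // => i _.
  by rewrite inner_conj (eqP (negbNE (ab0 i))) conjC0 normr0 expr0n.
by rewrite ob eqxx => /eqP; rewrite oner_eq0.
Qed.

End Inner.

Lemma lambda_max_eigenvector (R : realType) (d : nat) (X : 'M[R[i]]_d) :
    (0 < d)%N -> X \is hermsymmx ->
  exists2 v : 'cV[R[i]]_d, v != 0 & X *m v = (lambda_max X)%:C *: v.
Proof.
move=> d_gt0 hX; set l := lambda_max X.
have l_in : l \in eigenvalues X by rewrite mem_nth // size_eigenvalues.
have : root (char_poly X) l%:C.
  rewrite eigenvaluesP // -(big_map (fun x => x%:C) xpredT (fun z => 'X - z%:P)).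
  by rewrite root_prod_XsubC map_f.
rewrite -eigenvalue_root_char => /eigenvalueP[v vX v_neq0].
have /is_hermitianmxP := hX; rewrite expr0 scale1r => XE.
(* [eigenvalueP] yields a row eigenvector; its adjoint is a column eigenvector because [X] is
   Hermitian and [l] is real. *)
exists (map_mx Num.conj v^T); first by rewrite map_mx_eq0 trmx_eq0.
rewrite {1}XE -map_mxM -trmx_mul vX linearZ map_mxZ; congr (_ *: _).
by apply/CrealP/complex_realP; exists l.
Qed.

Lemma lambda_nonincreasing (R : realType) (n : nat) (X : 'M[R[i]]_n.+1) :
  {in [pred k | (k <= n)%N] &, {homo lambda X : i j / (i <= j)%N >-> j <= i}}.
Proof.
move=> i j; rewrite !inE => i_le j_le ij.
apply: (sorted_leq_nth _ _ 0 (eigenvalues_sorted _)) => //;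
  rewrite ?inE ?size_eigenvalues //.
  by move=> x y z yx xz; exact: le_trans xz yx.
by move=> x; exact: lexx.
Qed.

Theorem lemma1 (R : realType) (d : nat) (d_gt0 : (0 < d)%N)
    (A B : 'M[R[i]]_d) (a b : 'I_d -> 'cV[R[i]]_d)
    (hA : A \is hermsymmx) (hB : B \is hermsymmx)
    (oa : orthonormal_basis a) (ob : orthonormal_basis b)
    (ea : forall i : 'I_d, A *m a i = (lambda A i)%:C *: a i)
    (eb : forall j : 'I_d, B *m b j = (lambda B j)%:C *: b j) :
  lambda_max (A + B) <=
    seq_max [seq lambda A ij.1 + lambda B ij.2
            | ij : 'I_d * 'I_d <- enum {: 'I_d * 'I_d} & inner (a ij.1) (b ij.2) != 0].
Proof.
case: d d_gt0 A B a b hA hB oa ob ea eb => // n _ A B a b hA hB oa ob ea eb.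
set s := [seq _ | ij <- _ & _]; set M := seq_max s.
have in_s i j : inner (a i) (b j) != 0 -> lambda A i + lambda B j \in s.
  move=> ab; apply/mapP; exists (i, j) => //.
  by rewrite mem_filter ab mem_enum.
have s_neq0 : s != [::].
  have [i /in_s] := exists_inner_neq0 a b ord0 oa ob.
  by apply: contraTneq => ->.
have M_ub i j : inner (a i) (b j) != 0 -> lambda A i <= M - lambda B j.
  by move=> /in_s; rewrite lerBrDr; apply: (seq_maxP s_neq0).2.
have hAB : A + B \is hermsymmx.
  apply/is_hermitianmxP; move/is_hermitianmxP: hA; move/is_hermitianmxP: hB.
  by rewrite expr0 !scale1r linearD /= map_mxD => {1}-> {1}->.
have [v v_neq0 ev] := lambda_max_eigenvector R n.+1 (A + B) isT hAB.
(* The squared coefficients are taken in [R], since [sum_weighted_le] needs a total order, which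
   [R[i]] lacks. *)
pose w c := Normc.normc (inner v c) ^+ 2.
have wE c : `|inner v c| ^+ 2 = (w c)%:C by rewrite /w rmorphXn.
have w_sum (P : pred 'I_n.+1) (c : 'I_n.+1 -> 'cV_n.+1) :
    \sum_(i | P i) `|inner v (c i)| ^+ 2 = (\sum_(i | P i) w (c i))%:C.
  by rewrite rmorph_sum; apply: eq_bigr => i _; rewrite wE.
have wa : inner v v = (\sum_i w (a i))%:C.
  exact: etrans (parseval a v oa) (w_sum xpredT a).
have wb : inner v v = (\sum_j w (b j))%:C.
  exact: etrans (parseval b v ob) (w_sum xpredT b).
have w_gt0 : 0 < \sum_j w (b j).
  by rewrite -ltcR -wb inner_gt0.
have sum_w : \sum_i w (a i) = \sum_j w (b j).
  exact: (congr1 (@complex.Re R) (etrans (esym wa) wb)).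
have rayleigh : lambda_max (A + B) * \sum_j w (b j) =
    \sum_(i < n.+1) lambda A i * w (a i) +
    \sum_(j < n.+1) lambda B j * w (b j).
  apply: (@complexI R).
  rewrite rmorphM rmorphD /= -wb -innerZl -ev mulmxDl innerDl.
  rewrite (inner_diagonal _ _ _ _ oa ea) (inner_diagonal _ _ _ _ ob eb).
  congr (_ + _); rewrite rmorph_sum; apply: eq_bigr => i _.
    by rewrite wE; apply/esym/rmorphM.
  by rewrite wE; apply/esym/rmorphM.
(* By [rayleigh], and as the total weight is positive, it suffices to compare the forms of [A] and
   [M - B] at [v]. *)
suff AB : \sum_(i < n.+1) lambda A i * w (a i) <=
    \sum_(j < n.+1) (M - lambda B j) * w (b j).
  rewrite -(ler_pM2r w_gt0) rayleigh -lerBrDr mulr_sumr -sumrB.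
  by under [leRHS]eq_bigr do rewrite -mulrBl.
apply: (@sum_weighted_le R n _ (lambda A) (fun j : 'I_n.+1 => M - lambda B j)
  (fun i => w (a i)) (fun j => w (b j))).
- exact: lambda_nonincreasing.
(* Some [a i] is not orthogonal to [b j], and the smallest eigenvalue [lambda A n] is at most
   [lambda A i]. *)
- move=> j; have [i ab] := exists_inner_neq0 a b j oa ob.
  apply: le_trans (M_ub i j ab).
  by apply: lambda_nonincreasing; rewrite ?inE ?leq_ord.
- by move=> j; rewrite /w sqr_ge0.
- exact: sum_w.
(* Domination of projections, with [P i] being [i <= k] and [Q j] being
   [lambda A k <= M - lambda B j]. *)
- move=> k; rewrite -lecR -2!w_sum.
  apply: (le_sum_norm_inner a b v _ _ oa ob) => i j ik /M_ub; apply: le_trans.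
  by apply: lambda_nonincreasing; rewrite ?inE ?leq_ord.
Qed.
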